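(* Suppose each $f_i$ is strongly convex with constant $\mu_i>0$, $i=1,\dots,m$, and let $\mu=\min_i\mu_i$. Then the dual function $g$ is differentiable on $\mathbb{R}^{n(m-1)}$, and its gradient $\nabla g$ is Lipschitz continuous with constant $(1/\mu)\left[2+2\cos(\pi/m)\right]$.
   Context: Let $m\ge2$, $n\ge1$ be integers, $\mathcal{Y}\subseteq\mathbb{R}^n$ a nonempty closed convex set, and $f_i:\mathbb{R}^n\to\mathbb{R}$, $i=1,\dots,m$, strictly convex closed functions. For $\mathbf{y}=(\mathbf{y}_1,\dots,\mathbf{y}_m)\in(\mathbb{R}^n)^m=\mathbb{R}^{nm}$ put $f(\mathbf{y})=\sum_{i=1}^m f_i(\mathbf{y}_i)$, and $\mathbf{A}\mathbf{y}=(\mathbf{y}_1-\mathbf{y}_2,\dots,\mathbf{y}_{m-1}-\mathbf{y}_m)\in\mathbb{R}^{n(m-1)}$. The dual function is $g(\boldsymbol{\lambda})=\inf_{\mathbf{y}\in\mathcal{Y}^m}\big[f(\mathbf{y})+\boldsymbol{\lambda}^{T}\mathbf{A}\mathbf{y}\big]$, $\boldsymbol{\lambda}\in\mathbb{R}^{n(m-1)}$. Norms are Euclidean. A function $\varphi$ is strongly convex with constant $\sigma>0$ if $\varphi-\frac{\sigma}{2}\|\cdot\|^2$ is convex. *)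

(* Defs.v *)
From mathcomp Require Import all_boot all_order all_algebra.
From mathcomp Require Import all_classical all_reals all_analysis.

Set Implicit Arguments.
Unset Strict Implicit.
Unset Printing Implicit Defensive.

Import Order.TTheory GRing.Theory Num.Theory.
Import numFieldNormedType.Exports.

Local Open Scope classical_set_scope.
Local Open Scope ring_scope.

(* A vector of R^n is a row 'rV[R]_n, and a vector of R^(n p) is the matrix
   'M[R]_(p, n) whose rows are its p blocks in R^n. The library norm on matrices
   is the sup norm, whence the Euclidean norm below; the topology, and hence
   differentiability, is the same for both. *)
Definition edot (R : realType) (p n : nat) (x y : 'M[R]_(p, n)) : R :=
  \sum_(i < p) \sum_(j < n) x i j * y i j.

Definition enorm (R : realType) (p n : nat) (x : 'M[R]_(p, n)) : R :=
  Num.sqrt (edot x x).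

Definition strictly_convex (R : realType) (n : nat) (f : 'rV[R]_n -> R) : Prop :=
  forall (x y : 'rV[R]_n) (t : R), x != y -> 0 < t -> t < 1 ->
    f (t *: x + (1 - t) *: y) < t * f x + (1 - t) * f y.

Definition closed_function (R : realType) (n : nat) (f : 'rV[R]_n -> R) : Prop :=
  closed [set p : 'rV[R]_n * R | f p.1 <= p.2].

Definition strongly_convex (R : realType) (n : nat) (sigma : R)
    (f : 'rV[R]_n -> R) : Prop :=
  convex_function (E := 'rV[R]_n) [set: 'rV[R]_n]
    (fun x => f x - sigma / 2 * enorm x ^+ 2).

Definition ord_here (m : nat) (k : 'I_m.-1) : 'I_m := widen_ord (leq_pred m) k.

Lemma ord_next_subproof (m : nat) (k : 'I_m.-1) : (k.+1 < m)%N.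
Proof. by rewrite -ltn_predRL. Qed.

Definition ord_next (m : nat) (k : 'I_m.-1) : 'I_m :=
  Ordinal (ord_next_subproof k).

(* y |-> A y = (y_1 - y_2, ..., y_(m-1) - y_m) *)
Definition consecutive_diff (R : realType) (m n : nat) (y : 'M[R]_(m, n)) :
    'M[R]_(m.-1, n) :=
  \matrix_(k < m.-1, j < n) (y (ord_here k) j - y (ord_next k) j).

(* The infimum is taken in the extended reals, so that no finiteness is
   presupposed. *)
Definition dual_function (R : realType) (m n : nat) (Y : set 'rV[R]_n)
    (f : 'I_m -> 'rV[R]_n -> R) (l : 'M[R]_(m.-1, n)) : \bar R :=
  ereal_inf [set (\sum_(i < m) f i (row i y) + edot l (consecutive_diff y))%:E
            | y in [set y : 'M[R]_(m, n) | forall i, Y (row i y)]].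

Definition gradient (R : realType) (p n : nat) (g : 'M[R]_(p, n) -> R)
    (x : 'M[R]_(p, n)) : 'M[R]_(p, n) :=
  \matrix_(i < p, j < n) 'D_(delta_mx i j) g x.

(* Main.v *)
Require Import Defs.
From HB Require Import structures.
From mathcomp Require Import all_boot all_order all_algebra.
From mathcomp Require Import all_classical all_reals all_analysis.
From mathcomp Require Import ring lra zify.

(* Let phi_l(y) = f(y) + l^T A y. Each f_i is bounded below by a quadratic, so
   g(l) is finite; by strong convexity the minimizing sequences of phi_l on Y^m
   are Cauchy, with a limit y(l) such that
     phi_l(y) >= g(l) + mu/2 |y - y(l)|^2 on Y^m.
   Evaluating this along a minimizing sequence of phi_l' gives
     g(l) + mu/2 |y(l') - y(l)|^2 <= g(l') + (l - l')^T A y(l').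
   Since |A d|^2 <= c |d|^2 with c = 2 + 2 cos (pi / m), the largest eigenvalue
   of the Laplacian of the path with m vertices, this is the cocoercivity
   inequality of a concave function with gradient l |-> A y(l) and constant
   c / mu, from which differentiability and the Lipschitz bound follow. *)

Set Implicit Arguments.
Unset Strict Implicit.
Unset Printing Implicit Defensive.

Import Order.TTheory GRing.Theory Num.Theory.
Import numFieldNormedType.Exports.

Local Open Scope classical_set_scope.
Local Open Scope ring_scope.

Section Edot.
Context {R : realType} {p n : nat}.
Implicit Types x y z : 'M[R]_(p, n).

Lemma edotC x y : edot x y = edot y x.
Proof.
by apply: eq_bigr => i _; apply: eq_bigr => j _; rewrite mulrC.
Qed.

Lemma edotDl x y z : edot (x + y) z = edot x z + edot y z.
Proof.
rewrite /edot -big_split; apply: eq_bigr => i _ /=.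
by rewrite -big_split; apply: eq_bigr => j _; rewrite mxE mulrDl.
Qed.

Lemma edotZl a x y : edot (a *: x) y = a * edot x y.
Proof.
rewrite /edot mulr_sumr; apply: eq_bigr => i _.
by rewrite mulr_sumr; apply: eq_bigr => j _; rewrite mxE mulrA.
Qed.

Lemma edotDr x y z : edot x (y + z) = edot x y + edot x z.
Proof. by rewrite edotC edotDl !(edotC x). Qed.

Lemma edotZr a x y : edot x (a *: y) = a * edot x y.
Proof. by rewrite edotC edotZl edotC. Qed.

Lemma edotNl x y : edot (- x) y = - edot x y.
Proof. by rewrite -scaleN1r edotZl mulN1r. Qed.

Lemma edotNr x y : edot x (- y) = - edot x y.
Proof. by rewrite edotC edotNl edotC. Qed.

Definition edotE := (edotDl, edotDr, edotNl, edotNr, edotZl, edotZr).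

Lemma edotxx_ge0 x : 0 <= edot x x.
Proof. by do 2!apply: sumr_ge0 => ? _; rewrite -expr2 sqr_ge0. Qed.

Lemma sqr_enorm x : enorm x ^+ 2 = edot x x.
Proof. by rewrite sqr_sqrtr// edotxx_ge0. Qed.

Lemma edot_delta x i j : edot (delta_mx i j) x = x i j.
Proof.
rewrite /edot (bigD1 i)//= (bigD1 j)//= !mxE !eqxx mul1r !big1 ?addr0// => k ki.
  by rewrite big1// => l _; rewrite mxE (negbTE ki) mul0r.
by rewrite mxE (negbTE ki) andbF mul0r.
Qed.

Lemma sqr_entry_le x i j : x i j ^+ 2 <= edot x x.
Proof.
rewrite /edot (bigD1 i)//= (bigD1 j)//= -expr2 -addrA lerDl addr_ge0//.
  by apply: sumr_ge0 => k _; rewrite -expr2 sqr_ge0.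
by do 2!apply: sumr_ge0 => ? _; rewrite -expr2 sqr_ge0.
Qed.

Lemma edotxx_le_norm x : edot x x <= (p * n)%:R * `|x| ^+ 2.
Proof.
apply: (@le_trans _ _ (\sum_(i < p) \sum_(j < n) `|x| ^+ 2)).
  apply: ler_sum => i _; apply: ler_sum => j _.
  rewrite -expr2 -[leLHS]real_normK ?num_real// lerXn2r ?nnegrE//.
  rewrite [leRHS]/Num.Def.normr/= mx_normrE.
  exact: (le_bigmax _ (fun ij => `|x ij.1 ij.2|) (i, j)).
by rewrite !sumr_const !card_ord -mulrnA mulnC mulr_natl.
Qed.

Lemma edotxx_conv t x y :
  edot (t *: x + (1 - t) *: y) (t *: x + (1 - t) *: y) =
  t * edot x x + (1 - t) * edot y y - t * (1 - t) * edot (x - y) (x - y).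
Proof. by rewrite !edotE (edotC y x); ring. Qed.

Lemma cvg_edot (u v : nat -> 'M[R]_(p, n)) x y :
  (forall i j, (fun k => u k i j) @ \oo --> x i j) ->
  (forall i j, (fun k => v k i j) @ \oo --> y i j) ->
  (fun k => edot (u k) (v k)) @ \oo --> edot x y.
Proof.
move=> ux vy; apply: cvg_big => [|i _]; first exact: add_continuous.
apply: cvg_big => [|j _]; first exact: add_continuous.
exact: cvgM.
Qed.

End Edot.

Lemma edotxx_rows {R : realType} (m n : nat) (y : 'M[R]_(m, n)) :
  edot y y = \sum_(i < m) edot (row i y) (row i y).
Proof.
apply: eq_bigr => i _; rewrite /edot big_ord1.
by apply: eq_bigr => j _; rewrite !mxE.
Qed.

Section ConsecutiveDiff.
Context {R : realType}.

Lemma path_energy_le (c : R) (s x : nat -> R) (N j : nat) :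
  (forall k, (k <= N)%N -> 0 < s k) ->
  s 1%N = (c - 1) * s 0%N ->
  (forall k, s k.+2 = (c - 2) * s k.+1 - s k) ->
  (j <= N)%N ->
  \sum_(k < j) (x k - x k.+1) ^+ 2 <=
  c * (\sum_(k < j) x k ^+ 2) + (c - 1 - s j.+1 / s j) * x j ^+ 2.
Proof.
move=> s_gt0 s1 sS; elim: j => [_|j IH jN].
  by rewrite !big_ord0 s1 mulfK ?gt_eqF ?s_gt0// subrr mul0r mulr0 addr0.
have sj := s_gt0 _ (ltnW jN); have sj1 := s_gt0 _ jN.
have {}IH := IH (ltnW jN); rewrite !big_ord_recr/=.
set r := s j.+1 / s j in IH *.
have -> : c - 1 - s j.+2 / s j.+1 = 1 + r^-1.
  by rewrite sS /r; field; rewrite !gt_eqF.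
have r0 : 0 < r by rewrite divr_gt0.
have : 0 <= r^-1 * (r * x j + x j.+1) ^+ 2.
  by rewrite mulr_ge0 ?sqr_ge0 // invr_ge0 ltW.
have -> : r^-1 * (r * x j + x j.+1) ^+ 2 =
    r * x j ^+ 2 + 2 * x j * x j.+1 + r^-1 * x j.+1 ^+ 2.
  by field; rewrite gt_eqF.
lra.
Qed.

(* The largest eigenvalue of the Laplacian of the path with m vertices is
   2 + 2 cos (pi / m); with alternating signs, the sines below are the
   corresponding eigenvector. *)
Lemma path_energy_le_cos (x : nat -> R) (m : nat) :
  \sum_(k < m) (x k - x k.+1) ^+ 2 <=
  (2 + 2 * cos (pi / m.+1%:R)) * \sum_(k < m.+1) x k ^+ 2.
Proof.
set c := 2 + _; pose a : R := pi / m.+1%:R / 2.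
have a2 : a * 2 = pi / m.+1%:R by rewrite /a divfK.
have m0 : (m.+1%:R : R) != 0 by rewrite pnatr_eq0.
pose s k : R := sin ((2 * k%:R + 1) * a).
have a_gt0 : 0 < a by rewrite !divr_gt0 ?pi_gt0.
have am : (2 * m.+1%:R) * a = pi by rewrite /a; field; rewrite -?natr1 in m0 *.
have s_gt0 k : (k <= m)%N -> 0 < s k.
  move=> km; have k0 : 0 < 2 * k%:R + 1 :> R by rewrite ltr_wpDl// mulr_ge0.
  apply: sin_gt0_pi; rewrite mulr_gt0//=.
  by rewrite -am ltr_pM2r// -!natrM natr1 ltr_nat; lia.
have c2 : c - 2 = 2 * cos (a * 2) by rewrite /c a2; ring.
have sS k : s k.+2 = (c - 2) * s k.+1 - s k.
  rewrite c2 /s.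
  have -> : (2 * k.+2%:R + 1) * a = (2 * k.+1%:R + 1) * a + a * 2.
    by rewrite -[k.+2]addn1 natrD; ring.
  have -> : (2 * k%:R + 1) * a = (2 * k.+1%:R + 1) * a - a * 2.
    by rewrite -[k.+1]addn1 natrD; ring.
  by rewrite sinB sinD; ring.
have s1 : s 1%N = (c - 1) * s 0%N.
  have -> : c - 1 = (c - 2) + 1 by ring.
  rewrite c2 /s mulr0 add0r mul1r.
  have -> : (2 * 1 + 1) * a = a * 2 + a by ring.
  have sa : sin a = sin (a * 2) * cos a - cos (a * 2) * sin a.
    by rewrite -sinB; congr sin; ring.
  by rewrite sinD; lra.
have sm : s m.+1 = - s m.
  rewrite /s.
  have -> : (2 * m.+1%:R + 1) * a = a + pi by rewrite -am; ring.
  have -> : (2 * m%:R + 1) * a = pi - a by rewrite -am -[m.+1]addn1 natrD; ring.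
  by rewrite sinDpi sinB sinpi cospi; ring.
have := path_energy_le x s_gt0 s1 sS (leqnn m).
by rewrite sm mulNr divff ?gt_eqF ?s_gt0// opprK subrK big_ord_recr/= mulrDr.
Qed.

Lemma consecutive_diff_energy (m n : nat) (y : 'M[R]_(m, n)) : (0 < m)%N ->
  edot (consecutive_diff y) (consecutive_diff y) <=
  (2 + 2 * cos (pi / m%:R)) * edot y y.
Proof.
case: m y => // m y _; rewrite /edot exchange_big/= [X in _ * X]exchange_big/=.
rewrite mulr_sumr; apply: ler_sum => j _.
rewrite (eq_bigr (fun k : 'I_m => (y (inord k) j - y (inord k.+1) j) ^+ 2)).
  rewrite [X in _ * X](eq_bigr (fun k : 'I_m.+1 => y (inord k) j ^+ 2)).
    exact: (path_energy_le_cos (fun k => y (inord k) j)).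
  by move=> k _; rewrite inord_val expr2.
move=> k _; rewrite mxE -expr2; congr ((y _ _ - y _ _) ^+ 2).
  by apply/val_inj; rewrite /= inordK// ltnS ltnW.
by apply/val_inj; rewrite /= inordK// ltnS.
Qed.

Lemma consecutive_diffB (m n : nat) (x y : 'M[R]_(m, n)) :
  consecutive_diff (x - y) = consecutive_diff x - consecutive_diff y.
Proof. by apply/matrixP => i j; rewrite !mxE; ring. Qed.

Lemma consecutive_diff_conv (m n : nat) (t : R) (x y : 'M[R]_(m, n)) :
  consecutive_diff (t *: x + (1 - t) *: y) =
  t *: consecutive_diff x + (1 - t) *: consecutive_diff y.
Proof. by apply/matrixP => i j; rewrite !mxE; ring. Qed.

Lemma cvg_consecutive_diff (m n : nat) (u : nat -> 'M[R]_(m, n))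
    (y : 'M[R]_(m, n)) :
  (forall i j, (fun k => u k i j) @ \oo --> y i j) ->
  forall i j, (fun k => consecutive_diff (u k) i j) @ \oo -->
              consecutive_diff y i j.
Proof.
move=> uy i j; rewrite mxE.
under eq_fun do rewrite mxE.
exact: cvgB.
Qed.

End ConsecutiveDiff.

Section ConvexMinorant.
Context {R : realType}.

Lemma convex_functionP (n : nat) (q : 'rV[R]_n -> R) (x y : 'rV[R]_n) (t : R) :
  convex_function (E := 'rV[R]_n) [set: 'rV[R]_n] q -> 0 <= t -> t <= 1 ->
  q (t *: x + (1 - t) *: y) <= t * q x + (1 - t) * q y.
Proof.
move=> cq t0 t1; have /= := cq (Itv01 t0 t1) x y; apply; exact: in_setT.
Qed.

Lemma convex_jensen_le (n d : nat) (q : 'rV[R]_n -> R) (K : R)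
    (a : 'I_d -> R) (v : 'I_d -> 'rV[R]_n) :
  convex_function (E := 'rV[R]_n) [set: 'rV[R]_n] q ->
  (forall i, 0 <= a i) -> (forall i, q (v i) <= K) -> 0 < \sum_i a i ->
  q ((\sum_i a i)^-1 *: \sum_i a i *: v i) <= K.
Proof.
move=> cq a0 qv.
pose P (A : R) (W : 'rV[R]_n) :=
  [/\ 0 <= A, A = 0 -> W = 0 & 0 < A -> q (A^-1 *: W) <= K].
suff [] : P (\sum_i a i) (\sum_i a i *: v i) by [].
elim/big_rec2: _ => [|i W A _]; first by split => //; rewrite ltxx.
rewrite /P; have := a0 i; rewrite le_eqVlt => /predU1P[<-|ai0].
  by rewrite add0r scale0r add0r.
move=> [+ A0 qA]; rewrite le_eqVlt => /predU1P[A0'|A_gt0].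
  rewrite -A0' (A0 (esym A0')) !addr0; split => //.
    by move=> e; rewrite e ltxx in ai0.
  by move=> _; rewrite scalerA mulVf ?gt_eqF// scale1r.
have aA : 0 < a i + A by rewrite addr_gt0.
split => [|e|_]; [exact: ltW|by rewrite e ltxx in aA|].
have -> : (a i + A)^-1 *: (a i *: v i + W) =
    (a i / (a i + A)) *: v i + (1 - a i / (a i + A)) *: (A^-1 *: W).
  rewrite scalerDr !scalerA [_^-1 * a i]mulrC; congr (_ + _ *: _).
  by field; rewrite !gt_eqF.
have t0 : 0 <= a i / (a i + A) by rewrite divr_ge0// ltW.
have t1 : a i / (a i + A) <= 1 by rewrite ler_pdivrMr// mul1r lerDl ltW.
apply: le_trans (convex_functionP _ _ cq t0 t1) _.
have -> : K = a i / (a i + A) * K + (1 - a i / (a i + A)) * K by ring.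
by apply: lerD; rewrite ler_wpM2l ?subr_ge0// qA.
Qed.

(* Since 0 is a convex combination of y and of -y / |y|_1, and since q is
   bounded above on the unit ball of the 1-norm by its values at the
   vertices, q cannot decrease faster than linearly. *)
Lemma convex_minorant (n : nat) (q : 'rV[R]_n -> R) :
  convex_function (E := 'rV[R]_n) [set: 'rV[R]_n] q ->
  exists C, forall y : 'rV[R]_n, q 0 - C * (\sum_j `|y 0 j|) <= q y.
Proof.
move=> cq; pose e (j : 'I_n) : 'rV[R]_n := delta_mx 0 j.
pose K := \sum_j (`|q (e j)| + `|q (- e j)|).
have qK j : `|q (e j)| + `|q (- e j)| <= K.
  by rewrite /K (bigD1 j)//= lerDl sumr_ge0// => k _; rewrite addr_ge0.
exists (K - q 0) => y; set r := \sum_j _.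
have : 0 <= r by apply: sumr_ge0.
rewrite le_eqVlt => /predU1P[r0|r_gt0].
  suff -> : y = 0 by rewrite -r0 mulr0 subr0.
  apply/rowP => j; rewrite mxE; apply/eqP; rewrite -normr_eq0.
  move/esym/eqP: r0; rewrite psumr_eq0// => /allP/(_ j).
  by rewrite mem_index_enum; exact.
pose v j := if 0 <= y 0 j then - e j else e j.
have qv j : q (v j) <= K.
  apply: le_trans (qK j); rewrite /v; case: ifP => _.
    by rewrite (le_trans (ler_norm _))// lerDr.
  by rewrite (le_trans (ler_norm _))// lerDl.
have := convex_jensen_le cq (fun j => normr_ge0 (y 0 j)) qv r_gt0.
have -> : \sum_j `|y 0 j| *: v j = - y.
  rewrite [y in RHS]row_sum_delta -sumrN; apply: eq_bigr => j _.
  rewrite /v; case: ler0P => [|/ltW] yj.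
    case: ifP => [yj'|_]; last by rewrite scaleNr.
    have -> : y 0 j = 0 by apply/eqP; rewrite eq_le yj.
    by rewrite oppr0 !scale0r oppr0.
  by rewrite yj scalerN.
rewrite -/r => qz.
have r1 : 0 < 1 + r by rewrite addr_gt0.
have t0 : 0 <= (1 + r)^-1 by rewrite invr_ge0 ltW.
have t1 : (1 + r)^-1 <= 1 by rewrite invf_le1// lerDl ltW.
have := convex_functionP y (r^-1 *: - y) cq t0 t1.
have e1 : 1 - (1 + r)^-1 = r / (1 + r) by field; rewrite gt_eqF.
rewrite e1 scalerA mulrAC divff ?gt_eqF// mul1r scalerN subrr => q0.
have : q 0 <= (1 + r)^-1 * q y + r / (1 + r) * K.
  by apply: le_trans q0 _; rewrite lerD2l ler_wpM2l// divr_ge0// ltW.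
have -> : (1 + r)^-1 * q y + r / (1 + r) * K = (q y + r * K) / (1 + r).
  by field; rewrite gt_eqF.
by rewrite ler_pdivlMr//; lra.
Qed.

Lemma strongly_convex_conv (n : nat) (sigma : R) (f : 'rV[R]_n -> R)
    (x y : 'rV[R]_n) (t : R) :
  strongly_convex sigma f -> 0 <= t -> t <= 1 ->
  f (t *: x + (1 - t) *: y) <=
  t * f x + (1 - t) * f y - sigma / 2 * (t * (1 - t) * edot (x - y) (x - y)).
Proof.
move=> cf t0 t1; have := convex_functionP x y cf t0 t1.
by rewrite !sqr_enorm edotxx_conv; lra.
Qed.

Lemma strongly_convex_ge (n : nat) (sigma : R) (f : 'rV[R]_n -> R) :
  0 < sigma -> strongly_convex sigma f ->
  exists B, forall y : 'rV[R]_n, B + sigma / 4 * edot y y <= f y.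
Proof.
move=> s0 /convex_minorant[C Cq].
exists (f 0 - C ^+ 2 / sigma * n%:R) => y.
have := Cq y; rewrite !sqr_enorm.
have -> : edot (0 : 'rV[R]_n) 0 = 0.
  by rewrite -[X in edot X _](scale0r 0) edotZl mul0r.
rewrite mulr0 subr0 lerBrDr; apply: le_trans; rewrite -lerBlDr.
have yE : edot y y = \sum_j `|y 0 j| ^+ 2.
  rewrite /edot big_ord1; apply: eq_bigr => j _.
  by rewrite -expr2 real_normK// num_real.
rewrite yE -!addrA lerD2l.
suff : 0 <= \sum_j (sigma / 4 * `|y 0 j| ^+ 2 - C * `|y 0 j| + C ^+ 2 / sigma).
  rewrite !big_split/= sumrN -!mulr_sumr sumr_const card_ord -mulr_natr.
  by lra.
apply: sumr_ge0 => j _; set a := `|y 0 j|.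
have -> : sigma / 4 * a ^+ 2 - C * a + C ^+ 2 / sigma =
    (sigma * a / 2 - C) ^+ 2 / sigma by field; rewrite gt_eqF.
by rewrite mulr_ge0 ?sqr_ge0// invr_ge0 ltW.
Qed.

End ConvexMinorant.

Section StrongMinimization.
Context {R : realType} {m n : nat}.
Implicit Types (S : set 'M[R]_(m, n)) (h : 'M[R]_(m, n) -> R).

Lemma cauchy_entries (u : nat -> 'M[R]_(m, n)) (M : R) :
  (forall k l, edot (u k - u l) (u k - u l) <= M * (k.+1%:R^-1 + l.+1%:R^-1)) ->
  exists y : 'M[R]_(m, n),
    forall i j, (fun k => u k i j) @ \oo --> y i j.
Proof.
move=> uM; exists (\matrix_(i, j) lim ((fun k => u k i j) @ \oo)) => i j.
rewrite mxE; apply/cauchy_cvgP/cauchy_exP => e e0.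
have d0 : 0 < e ^+ 2 / (2 * (`|M| + 1)).
  by rewrite divr_gt0 ?exprn_gt0// mulr_gt0// ltr_wpDl.
have [N _ HN] := near_infty_natSinv_lt (PosNum d0).
exists (u N i j); exists N => // l Nl /=; rewrite /ball/=.
rewrite -(@ltr_pXn2r _ 2)// ?nnegrE ?ltW// real_normK ?num_real//.
have -> : u N i j - u l i j = (u N - u l) i j by rewrite !mxE.
apply: le_lt_trans (sqr_entry_le _ _ _) _; apply: le_lt_trans (uM _ _) _.
have := HN N (leqnn N); have := HN l Nl => /=; rewrite !ltr_pdivlMr ?mulr_gt0 ?ltr_wpDl//.
set a := N.+1%:R^-1; set b := l.+1%:R^-1 => hb ha.
have a0 : 0 < a by rewrite invr_gt0.
have b0 : 0 < b by rewrite invr_gt0.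
have : M * (a + b) <= `|M| * (a + b) by rewrite ler_pM2r ?ler_norm// addr_gt0.
lra.
Qed.

(* The point ystar is the limit of a minimizing sequence; without closedness
   assumptions it need not lie in S nor realize the infimum of h. *)
Lemma strong_minimization S h (sigma B : R) : 0 < sigma -> S !=set0 ->
  (forall x y t, S x -> S y -> 0 < t -> t < 1 ->
    S (t *: x + (1 - t) *: y) /\
    h (t *: x + (1 - t) *: y) <=
    t * h x + (1 - t) * h y - sigma / 2 * (t * (1 - t) * edot (x - y) (x - y))) ->
  (forall y, S y -> B <= h y) ->
  exists (G : R) (ystar : 'M[R]_(m, n)) (u : nat -> 'M[R]_(m, n)),
    [/\ ereal_inf [set (h y)%:E | y in S] = G%:E,
        forall y, S y -> G + sigma / 2 * edot (y - ystar) (y - ystar) <= h y,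
        forall k, S (u k),
        h \o u @ \oo --> G &
        forall i j, (fun k => u k i j) @ \oo --> ystar i j].
Proof.
move=> s0 [y0 Sy0] hconv hB.
have hS0 : (h @` S) !=set0 by exists (h y0), y0.
have hSB : has_lbound (h @` S) by exists B => _ [y Sy <-]; exact: hB.
pose G := inf (h @` S).
have Gle y : S y -> G <= h y by move=> Sy; apply: ge_inf => //; exists y.
have /choice[u uP] : forall k : nat,
    exists y, S y /\ h y < G + k.+1%:R^-1.
  move=> k; have k0 : 0 < k.+1%:R^-1 :> R by rewrite invr_gt0.
  have [_ [y Sy <-] hy] := inf_adherent k0 (conj hS0 hSB).
  by exists y.
have Su k : S (u k) by have [] := uP k.
have hu : h \o u @ \oo --> G.
  apply: (@squeeze_cvgr _ _ _ _ (cst G) (fun k => G + harmonic k)).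
  - by apply: nearW => k /=; rewrite Gle// ltW//; have [] := uP k.
  - exact: cvg_cst.
  - rewrite -[X in _ --> X]addr0; apply: cvgD; first exact: cvg_cst.
    exact: cvg_harmonic.
have [ystar uy] : exists y : 'M[R]_(m, n),
    forall i j, (fun k => u k i j) @ \oo --> y i j.
  apply: (@cauchy_entries u (4 / sigma)) => k l.
  have h0 : 0 < 2^-1 :> R by rewrite invr_gt0.
  have h1 : 2^-1 < 1 :> R by rewrite invf_lt1// ltr1n.
  have [Sx hx] := hconv _ _ _ (Su k) (Su l) h0 h1.
  have {Sx hx} := le_trans (Gle _ Sx) hx.
  have [_] := uP k; have [_] := uP l.
  set a := k.+1%:R^-1; set b := l.+1%:R^-1; set D := edot _ _ => hb ha hx.
  rewrite mulrAC ler_pdivlMr//.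
  have e : (1 : R) - 2^-1 = 2^-1 by field.
  rewrite e in hx.
  have -> : D * sigma = 8 * (sigma / 2 * (2^-1 / 2 * D)) by field.
  lra.
exists G, ystar, u; split => //.
  by rewrite -(ereal_inf_EFin hSB hS0) image_comp.
move=> y Sy; set D := edot _ _.
have key t : 0 < t -> t < 1 -> (1 - t) * (sigma / 2 * D) <= h y - G.
  move=> t0 t1.
  have cvk : (fun k => t * h y + (1 - t) * h (u k) -
      sigma / 2 * (t * (1 - t) * edot (y - u k) (y - u k))) @ \oo -->
      t * h y + (1 - t) * G - sigma / 2 * (t * (1 - t) * D).
    have yu i j : (fun k => (y - u k) i j) @ \oo --> (y - ystar) i j.
      rewrite !mxE; under eq_fun do rewrite !mxE.
      by apply: cvgB; [exact: cvg_cst|exact: uy].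
    apply: cvgB; last by do 2!apply: cvgMr; exact: cvg_edot.
    by apply: cvgD; [exact: cvg_cst|exact: cvgMr].
  have : G <= t * h y + (1 - t) * G - sigma / 2 * (t * (1 - t) * D).
    rewrite -(cvg_lim _ cvk)//; apply: limr_ge; first by apply/cvg_ex; eexists; exact: cvk.
    apply: nearW => k; have [Sx hx] := hconv _ _ _ Sy (Su k) t0 t1.
    exact: le_trans (Gle _ Sx) hx.
  rewrite -subr_ge0.
  have -> : t * h y + (1 - t) * G - sigma / 2 * (t * (1 - t) * D) - G =
      t * (h y - G - (1 - t) * (sigma / 2 * D)) by ring.
  by rewrite pmulr_rge0// subr_ge0.
rewrite -lerBrDl leNgt; apply/negP => lt.
move: (sigma / 2 * D) key lt => a key lt.
have hG : 0 <= h y - G by rewrite subr_ge0 Gle.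
have a0 : 0 < a by exact: le_lt_trans lt.
have t0 : 0 < (a - (h y - G)) / (2 * a).
  by rewrite divr_gt0 ?mulr_gt0// subr_gt0.
have t1 : (a - (h y - G)) / (2 * a) < 1.
  by rewrite ltr_pdivrMr ?mulr_gt0//; lra.
have := key _ t0 t1.
have -> : (1 - (a - (h y - G)) / (2 * a)) * a = (a + (h y - G)) / 2.
  by field; rewrite gt_eqF.
lra.
Qed.

End StrongMinimization.

(* The codomain is cast to R^o below because linear maps need an lmodType. *)
Definition edotr {R : realType} {p n : nat} (w : 'M[R]_(p, n)) : 'M[R]_(p, n) -> R :=
  fun h => edot h w.

Fact edotr_is_linear {R : realType} {p n : nat} (w : 'M[R]_(p, n)) :
  linear_for (@GRing.scale R R^o) (edotr w : 'M[R]_(p, n) -> R^o).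
Proof. by move=> a x y; rewrite /edotr edotDl edotZl. Qed.

HB.instance Definition _ (R : realType) (p n : nat) (w : 'M[R]_(p, n)) :=
  GRing.isLinear.Build R 'M[R]_(p, n) R^o *:%R (edotr w : 'M[R]_(p, n) -> R^o)
    (edotr_is_linear w).

Section CocoerciveGradient.
Context {R : realType} {p n : nat}.
Context (g : 'M[R]_(p, n) -> R) (w : 'M[R]_(p, n) -> 'M[R]_(p, n)) (L : R)
  (L_gt0 : 0 < L)
  (g_coco : forall l l',
    g l + (2 * L)^-1 * edot (w l' - w l) (w l' - w l) <=
    g l' + edot (l - l') (w l')).

Lemma coco_remainder l h :
  `|g (h + l) - (g l + edot h (w l))| <= L / 2 * edot h h.
Proof.
have := g_coco l (h + l); have := g_coco (h + l) l.
rewrite addrK opprD addrCA subrr addr0 -/(- h).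
set D := w (h + l) - w l.
have wE : w (h + l) = w l + D by rewrite /D [RHS]addrC subrK.
have -> : w l - w (h + l) = - D by rewrite opprB.
rewrite {}wE; clearbody D; rewrite !edotE => hu hl.
have hD : 0 <= (2 * L)^-1 * edot D D.
  by rewrite mulr_ge0 ?edotxx_ge0// invr_ge0 ltW// mulr_gt0.
have hh : 0 <= L / 2 * edot h h by rewrite mulr_ge0 ?edotxx_ge0// divr_ge0// ltW.
have sq : 0 <= L / 2 * edot h h + edot h D + (2 * L)^-1 * edot D D.
  have -> : L / 2 * edot h h + edot h D + (2 * L)^-1 * edot D D =
      (2 * L)^-1 * edot (L *: h + D) (L *: h + D).
    by rewrite !edotE (edotC D h); field; rewrite gt_eqF.
  by rewrite mulr_ge0 ?edotxx_ge0// invr_ge0 ltW// mulr_gt0.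
rewrite ler_norml; apply/andP; split; lra.
Qed.

Lemma edotr_continuous (v : 'M[R]_(p, n)) : continuous (edotr v).
Proof.
apply: continuous_big => [|i _]; first exact: add_continuous.
apply: continuous_big => [|j _]; first exact: add_continuous.
by move=> x; exact: (cvgM (@coord_continuous R p n i j x) (cvg_cst (v i j))).
Qed.

Lemma coco_littleo (l : 'M[R]_(p, n)) :
  (g : 'M[R]_(p, n) -> R^o) \o shift l =
  cst (g l : R^o) + (edotr (w l) : 'M[R]_(p, n) -> R^o) +o_ (0 : 'M[R]_(p, n)) id.
Proof.
apply/eqaddoP => e e0.
pose M : R := L / 2 * (p * n)%:R + 1.
have M0 : 0 < M by rewrite ltr_wpDl// mulr_ge0// divr_ge0// ltW.
have eM : 0 < e / M by rewrite divr_gt0.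
near=> h.
have he : `|h| <= e / M.
  by near: h; apply: (@nbhs0_le _ 'M[R]_(p, n)).
apply: le_trans (coco_remainder l h) _.
apply: (@le_trans _ _ (M * `|h| ^+ 2)).
  apply: (@le_trans _ _ (L / 2 * ((p * n)%:R * `|h| ^+ 2))).
    by rewrite ler_wpM2l ?edotxx_le_norm// divr_ge0// ltW.
  by rewrite mulrA ler_wpM2r ?exprn_ge0// lerDl.
rewrite expr2 mulrA ler_wpM2r// mulrC.
by rewrite ler_pdivlMr in he.
Unshelve. all: by end_near. Qed.

Lemma coco_diff l : 'd g l = edotr (w l) :> (_ -> _).
Proof.
exact: (@diff_unique _ _ _ g (edotr (w l)) l (@edotr_continuous _)
  (coco_littleo l)).
Qed.

Lemma coco_differentiable l : differentiable g l.
Proof.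
apply/diff_locallyP; rewrite coco_diff; split; first exact: edotr_continuous.
exact: coco_littleo.
Qed.

Lemma coco_gradient l : gradient g l = w l.
Proof.
apply/matrixP => i j; rewrite mxE deriveE; last exact: coco_differentiable.
by rewrite coco_diff /edotr edot_delta.
Qed.

Lemma coco_lipschitz l l' :
  enorm (gradient g l - gradient g l') <= L * enorm (l - l').
Proof.
rewrite !coco_gradient -(@ler_pXn2r _ 2)// ?nnegrE ?mulr_ge0 ?sqrtr_ge0 ?(ltW L_gt0)//.
rewrite exprMn !sqr_enorm.
have := g_coco l l'; have := g_coco l' l.
rewrite -(opprB l) -(opprB (w l)).
set d := w l - w l'; set h := l - l'.
have wE : w l = w l' + d by rewrite /d [RHS]addrC subrK.
rewrite {}wE; clearbody d h; rewrite !edotE => hu hl.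
have : 0 <= edot (L *: h + d) (L *: h + d) by exact: edotxx_ge0.
rewrite !edotE (edotC d h).
have : L * (2 * ((2 * L)^-1 * edot d d)) <= L * - edot h d.
  by rewrite ler_pM2l//; lra.
have -> : L * (2 * ((2 * L)^-1 * edot d d)) = edot d d by field; rewrite gt_eqF.
lra.
Qed.

End CocoerciveGradient.

Theorem proposition1 (R : realType) (m n : nat) (hm : (2 <= m)%N)
  (hn : (1 <= n)%N)
  (Y : set 'rV[R]_n) (Y_nonempty : Y !=set0) (Y_closed : closed Y)
  (Y_convex : convex_set (M := 'rV[R]_n) Y)
  (f : 'I_m -> 'rV[R]_n -> R)
  (f_strict : forall i, strictly_convex (f i))
  (f_closed : forall i, closed_function (f i))
  (mu_ : 'I_m -> R) (mu_gt0 : forall i, 0 < mu_ i)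
  (f_strong : forall i, strongly_convex (mu_ i) (f i))
  (mu : R) (mu_min_le : forall i, mu <= mu_ i)
  (mu_min_attained : exists i, mu = mu_ i) :
  (forall l : 'M[R]_(m.-1, n), dual_function Y f l \is a fin_num) /\
  (let g := fun l : 'M[R]_(m.-1, n) => fine (dual_function Y f l) in
   (forall l : 'M[R]_(m.-1, n), differentiable g l) /\
   (forall l l' : 'M[R]_(m.-1, n),
      enorm (gradient g l - gradient g l') <=
      (1 / mu * (2 + 2 * cos (pi / m%:R))) * enorm (l - l'))).
Proof.
have mu0 : 0 < mu by have [i ->] := mu_min_attained.
have m0 : (0 < m)%N by exact: ltnW.
set c := 2 + 2 * cos (pi / m%:R).
have c0 : 0 < c.
  rewrite ltr_pwDl// mulr_ge0// cos_ge0_pihalf//; apply/andP; split.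
    by rewrite (le_trans (y := 0)) ?oppr_le0 ?divr_ge0// ?pi_ge0.
  by rewrite ler_pM2l ?pi_gt0// lef_pV2 ?posrE ?ltr0n// ler_nat.
pose S := [set y : 'M[R]_(m, n) | forall i, Y (row i y)].
pose h (l : 'M[R]_(m.-1, n)) (y : 'M[R]_(m, n)) :=
  \sum_(i < m) f i (row i y) + edot l (consecutive_diff y).
have S0 : S !=set0.
  have [v Yv] := Y_nonempty; exists (\matrix_(i, j) v 0 j) => i /=.
  suff -> : row i (\matrix_(i, j) v 0 j) = v by [].
  by apply/rowP => j; rewrite !mxE.
have S_conv x y t : S x -> S y -> 0 < t -> t < 1 -> S (t *: x + (1 - t) *: y).
  move=> Sx Sy t0 t1 i; rewrite linearD !linearZ/=.
  have := Y_convex (row i x) (row i y) (Itv01 (ltW t0) (ltW t1)).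
  by rewrite !inE; apply; [exact: Sx|exact: Sy].
have h_conv l x y t : S x -> S y -> 0 < t -> t < 1 ->
    S (t *: x + (1 - t) *: y) /\
    h l (t *: x + (1 - t) *: y) <= t * h l x + (1 - t) * h l y -
      mu / 2 * (t * (1 - t) * edot (x - y) (x - y)).
  move=> Sx Sy t0 t1; split; first exact: S_conv.
  rewrite /h consecutive_diff_conv (edotDr l) !(edotZr _ l).
  suff : \sum_(i < m) f i (row i (t *: x + (1 - t) *: y)) <=
      t * (\sum_(i < m) f i (row i x)) + (1 - t) * (\sum_(i < m) f i (row i y))
      - mu / 2 * (t * (1 - t) * edot (x - y) (x - y)) by lra.
  rewrite (edotxx_rows (x - y)) !mulr_sumr -big_split -sumrB/=.
  apply: ler_sum => i _.
  have -> : row i (t *: x + (1 - t) *: y) = t *: row i x + (1 - t) *: row i y.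
    by rewrite linearD !linearZ.
  have -> : row i (x - y) = row i x - row i y by rewrite linearB.
  apply: le_trans (strongly_convex_conv _ _ (f_strong i) (ltW t0) (ltW t1)) _.
  rewrite lerD2l lerN2 ler_wpM2r ?ler_pM2r// mulr_ge0 ?edotxx_ge0//.
  by rewrite mulr_ge0 ?subr_ge0 ?ltW.
have h_ge l : exists B, forall y, S y -> B <= h l y.
  have /choice[b fb] : forall i, exists B, forall y : 'rV[R]_n,
      B + mu_ i / 4 * edot y y <= f i y.
    by move=> i; exact: strongly_convex_ge.
  exists (\sum_i b i - c / mu * edot l l) => y _; rewrite /h.
  have Fy : \sum_i b i + mu / 4 * edot y y <= \sum_(i < m) f i (row i y).
    rewrite edotxx_rows mulr_sumr -big_split; apply: ler_sum => i _ /=.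
    apply: le_trans (fb i _); rewrite lerD2l ler_wpM2r ?edotxx_ge0//.
    by rewrite ler_pM2r.
  have Ay := consecutive_diff_energy y m0; rewrite -/c in Ay.
  set z := consecutive_diff y in Ay *.
  have := edotxx_ge0 ((2 * c / mu) *: l + z).
  rewrite !edotE (edotC z l) => ge0.
  have : 0 <= mu / (4 * c) * ((2 * c / mu) * ((2 * c / mu) * edot l l + edot l z) +
      ((2 * c / mu) * edot l z + c * edot y y)).
    rewrite mulr_ge0//; first by rewrite divr_ge0 ?mulr_ge0 ?ltW.
    by lra.
  have -> : mu / (4 * c) * ((2 * c / mu) * ((2 * c / mu) * edot l l + edot l z) +
      ((2 * c / mu) * edot l z + c * edot y y)) =
      c / mu * edot l l + edot l z + mu / 4 * edot y y.
    by field; rewrite !gt_eqF.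
  by lra.
have /choice[G /choice[ystar yP]] : forall l, exists (a : R)
    (ystar : 'M[R]_(m, n)) (u : nat -> 'M[R]_(m, n)),
    [/\ ereal_inf [set (h l y)%:E | y in S] = a%:E,
        forall y, S y -> a + mu / 2 * edot (y - ystar) (y - ystar) <= h l y,
        forall k, S (u k),
        h l \o u @ \oo --> a &
        forall i j, (fun k => u k i j) @ \oo --> ystar i j].
  move=> l; have [B hB] := h_ge l.
  exact: strong_minimization mu0 S0 (h_conv l) hB.
have gE l : dual_function Y f l = (G l)%:E by have [? []] := yP l.
have -> : (fun l => fine (dual_function Y f l)) = G.
  by apply/funext => l; rewrite gE.
have G_le l l' : G l + mu / 2 * edot (ystar l' - ystar l) (ystar l' - ystar l)
    <= G l' + edot (l - l') (consecutive_diff (ystar l')).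
  have [_ [_ lower _ _ _]] := yP l; have [u [_ _ Su hu uy]] := yP l'.
  have cvl : (fun k => G l + mu / 2 * edot (u k - ystar l) (u k - ystar l)) @ \oo
      --> G l + mu / 2 * edot (ystar l' - ystar l) (ystar l' - ystar l).
    have uy' i j : (fun k => (u k - ystar l) i j) @ \oo -->
        (ystar l' - ystar l) i j.
      rewrite !mxE; under eq_fun do rewrite !mxE.
      by apply: cvgB; [exact: uy|exact: cvg_cst].
    by apply: cvgD; [exact: cvg_cst|apply: cvgMr; exact: cvg_edot].
  have cvr : (fun k => h l' (u k) + edot (l - l') (consecutive_diff (u k))) @ \oo
      --> G l' + edot (l - l') (consecutive_diff (ystar l')).
    apply: cvgD; first exact: hu.
    apply: cvg_edot; first by move=> i j; exact: cvg_cst.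
    exact: cvg_consecutive_diff.
  apply: (ler_cvg_to cvl cvr); apply: nearW => k /=.
  apply: le_trans (lower _ (Su k)) _; rewrite /h edotDl edotNl; lra.
have L0 : 0 < 1 / mu * c by rewrite mulr_gt0// divr_gt0.
have G_coco l l' : G l + (2 * (1 / mu * c))^-1 *
    edot (consecutive_diff (ystar l') - consecutive_diff (ystar l))
         (consecutive_diff (ystar l') - consecutive_diff (ystar l))
    <= G l' + edot (l - l') (consecutive_diff (ystar l')).
  apply: le_trans (G_le l l'); rewrite lerD2l -consecutive_diffB.
  have K0 : 0 <= (2 * (1 / mu * c))^-1 by rewrite invr_ge0 mulr_ge0// ltW.
  have -> : mu / 2 = (2 * (1 / mu * c))^-1 * c by field; rewrite !gt_eqF.
  rewrite -[leRHS]mulrA.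
  exact: ler_wpM2l K0 _ _ (consecutive_diff_energy _ m0).
split=> [l|/=]; first by rewrite gE.
split=> [l|l l']; first exact: (coco_differentiable L0 G_coco).
exact: (coco_lipschitz L0 G_coco).
Qed.
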